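(* Let $n,k,n',k'$ be integers with $k<n<2k-1$, $n/k=n'/k'$, and $k,k'$ both even. Then there is a homomorphism $H_{n,k}\to H_{n',k'}$ if and only if $n'$ and $k'$ are integer multiples of $n$ and $k$, respectively. Moreover, any homomorphism $H_{n,k}\to H_{n',k'}$ is an isomorphism from $H_{n,k}$ to an induced subgraph of $H_{n',k'}$.
   Context: For integers $m\ge j$ with $j$ even, $H_{m,j}$ is the graph whose vertices are the even-weight elements of $\mathbb{Z}_2^m$, with $x\sim y$ iff $x$ and $y$ differ in exactly $j$ coordinates. A homomorphism is an adjacency-preserving map between vertex sets. *)

(* Defs.v *)
From mathcomp Require Import all_boot.
Set Implicit Arguments. Unset Strict Implicit. Unset Printing Implicit Defensive.

(* Elements of Z_2^m are encoded as boolean functions on 'I_m. *)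
Definition weight (m : nat) (x : {ffun 'I_m -> bool}) : nat := #|[set i | x i]|.

Definition hdist (m : nat) (x y : {ffun 'I_m -> bool}) : nat :=
  #|[set i | x i != y i]|.

Definition HV (m : nat) := {x : {ffun 'I_m -> bool} | ~~ odd (weight x)}.

Definition Hadj {m : nat} (j : nat) (x y : HV m) : bool := hdist (val x) (val y) == j.

Definition is_hom (m j m' j' : nat) (f : HV m -> HV m') : Prop :=
  forall x y : HV m, Hadj j x y -> Hadj j' (f x) (f y).

Definition is_induced_embedding (m j m' j' : nat) (f : HV m -> HV m') : Prop :=
  injective f /\ forall x y : HV m, Hadj j' (f x) (f y) = Hadj j x y.

Arguments is_hom : clear implicits.
Arguments is_induced_embedding : clear implicits.

(* Main.v *)
(* Write K_j(s) for the Krawtchouk numbers, the eigenvalues of the distance-j graph of the cube. For k even with n < 2k - 1, the three-term recurrence shows that K_k takes its least value only at s = 1 and s = n - 1.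

   Given a homomorphism f, consider the functions x |-> (-1)^(f x)_i, extended by 0 to odd x. Since n/k = n'/k', their quadratic forms sum to K_k(1) times the sum of their squared norms, so all of them lie in the least eigenspace, which on even words consists of the combinations sum_a u_a (-1)^(x_a). As n > 4, such a combination has values in {1, -1} only if it is a single signed term. Hence every coordinate of f x is a coordinate of x, possibly negated. Counting edges, every coordinate of x is used the same number r of times, so f multiplies distances by r. *)

Require Import Defs.
From mathcomp Require Import all_boot all_order all_algebra.
From mathcomp Require Import ring lra zify.
Set Implicit Arguments. Unset Strict Implicit. Unset Printing Implicit Defensive.
Import Order.TTheory GRing.Theory Num.Theory.

Lemma ex_subset_card (T : finType) (A : {set T}) k :
  k <= #|A| -> exists2 B : {set T}, B \subset A & #|B| = k.
Proof.
rewrite -bin_gt0 -cards_draws => /card_gt0P[B]; rewrite inE => /andP[BA /eqP kB].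
by exists B.
Qed.

(** * Krawtchouk numbers: generating function, recurrence, symmetries and the spectral gap *)

Section Krawtchouk.
Local Open Scope ring_scope.

(** Generating function of the Krawtchouk numbers in the degree, meaningful for [s <= n]. *)
Definition kraw_poly (n s : nat) : {poly rat} :=
  (1 - 'X) ^+ s * (1 + 'X) ^+ (n - s).

(* Here [n] is the length, [s] the evaluation point and [j] the degree: [kraw n s j] is K_j(s). *)
Definition kraw (n s j : nat) : rat := (kraw_poly n s)`_j.

(** Write the generating function as a product over coordinates, with factor 1 - X on [S] and 1 + X
    off it. Expanding means choosing the set [T] of coordinates that contribute X. The sum is the
    eigenvalue of the distance-[j] graph at the character of [S]. *)
Lemma kraw_sum n (S : {set 'I_n}) j :
  \sum_(T : {set 'I_n} | #|T| == j) (-1) ^+ #|S :&: T| = kraw n #|S| j.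
Proof.
rewrite /kraw.
suff -> : kraw_poly n #|S|
        = \sum_(T : {set 'I_n}) (-1) ^+ #|S :&: T| *: 'X^#|T|.
  rewrite coef_sum big_mkcond; apply: eq_bigr => T _.
  by rewrite coefZ coefXn eq_sym; case: eqP; rewrite ?mulr1 ?mulr0.
rewrite /kraw_poly.
have -> : (1 - 'X) ^+ #|S| * (1 + 'X) ^+ (n - #|S|)
        = \prod_i ((if i \in S then -1 else 1) *: 'X + 1) :> {poly rat}.
  rewrite (bigID (mem S)) /= -prodr_const; congr (_ * _).
    by apply: eq_bigr => i ->; rewrite scaleN1r addrC.
  rewrite (eq_bigr (fun=> 1 + 'X)) => [|i /negbTE->]; last by rewrite scale1r addrC.
  rewrite prodr_const; congr (_ ^+ _).
  have -> : (n - #|S|)%N = #|~: S| by rewrite [RHS]cardsCs setCK card_ord.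
  by apply: eq_card => i; rewrite !inE.
rewrite bigA_distr; apply: eq_bigr => T _.
rewrite -big_mkcond /=.
rewrite -!prodr_const -mul_polyC.
rewrite [LHS](eq_bigr (fun i => (if i \in S then -1 else 1)%:P * 'X)) => [|i _];
  last by rewrite mul_polyC.
rewrite big_split /=; congr (_ * _).
rewrite rmorph_prod /= (bigID (mem S)) /= [X in _ * X]big1 ?mulr1 => [|i /andP[_ /negbTE->] //].
rewrite (eq_bigl (mem (S :&: T))) => [|i]; last by rewrite !inE andbC.
by apply: eq_bigr => i; rewrite !inE => /andP[->].
Qed.

(** This is the logarithmic derivative with denominators cleared; comparing coefficients yields the
    recurrence in the degree. *)
Lemma deriv_kraw_poly n s : (s <= n)%N ->
  (1 - 'X^2) * (kraw_poly n s)^`() = ((n%:R - s%:R *+ 2) - n%:R * 'X) * kraw_poly n s.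
Proof.
move=> sn; rewrite /kraw_poly derivM.
have dl (m : nat) : (1 - 'X) * ((1 - 'X) ^+ m)^`() = - m%:R * (1 - 'X) ^+ m :> {poly rat}.
  rewrite deriv_exp derivB derivX -[1]/(1%:P) derivC sub0r; case: m => [|m /=].
    by rewrite mulr0n; ring.
  by rewrite exprS -mulr_natl; ring.
have dr (m : nat) : (1 + 'X) * ((1 + 'X) ^+ m)^`() = m%:R * (1 + 'X) ^+ m :> {poly rat}.
  rewrite deriv_exp derivD derivX -[1]/(1%:P) derivC add0r; case: m => [|m /=].
    by rewrite mulr0n; ring.
  by rewrite exprS -mulr_natl; ring.
have := dl s; have := dr (n - s)%N; rewrite natrB //.
set p := (1 - 'X) ^+ s; set q := (1 + 'X) ^+ _ => dq dp.
have -> : (1 - 'X^2) * (p^`() * q + p * q^`()) =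
  (1 + 'X) * q * ((1 - 'X) * p^`()) + (1 - 'X) * p * ((1 + 'X) * q^`()) :> {poly rat} by ring.
by rewrite dp dq; ring.
Qed.

Lemma kraw_rec n s j : (s <= n)%N ->
  j.+2%:R * kraw n s j.+2 =
  (n%:R - s%:R *+ 2) * kraw n s j.+1 - (n%:R - j%:R) * kraw n s j.
Proof.
move=> sn; have /(congr1 (fun p : {poly rat} => p`_j.+1)) := deriv_kraw_poly sn.
rewrite !mulrBl mul1r !coefB -[n%:R * 'X * _]mulrA.
rewrite -polyC_natr -!polyCMn -!mulrA !coefCM.
rewrite !coefXM !coef_deriv /= /kraw.
case: j => [|j] /=; set p := kraw_poly n s.
  move: p`_0 p`_1 p`_2 => p0 p1 p2; lra.
move: p`_j.+1 p`_j.+2 p`_j.+3 => p0 p1 p2; lra.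
Qed.

Lemma kraw0 n s : kraw n s 0 = 1.
Proof. by rewrite /kraw -horner_coef0 /kraw_poly !hornerE !expr1n mulr1. Qed.

Lemma kraw1 n s : (s <= n)%N -> kraw n s 1 = n%:R - s%:R *+ 2.
Proof.
move=> sn; have /(congr1 (fun p : {poly rat} => p`_0)) := deriv_kraw_poly sn.
rewrite !mulrBl mul1r !coefB -[n%:R * 'X * _]mulrA.
rewrite -polyC_natr -!polyCMn -!mulrA !coefCM.
rewrite !coefXM !coef_deriv /= -/(kraw n s 1) -/(kraw n s 0) kraw0.
by rewrite mulr1n !mulr0 !mulr1 !subr0.
Qed.

(** With this normalization, [kraw_sym] says that the point and the degree can be exchanged. *)
Definition nkraw (n s j : nat) : rat := kraw n s j / 'C(n, j)%:R.

Lemma nkraw0 n s : nkraw n s 0 = 1.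
Proof. by rewrite /nkraw kraw0 bin0 divr1. Qed.

Lemma nkraw1 n s : (s <= n)%N -> nkraw n s 1 = (n%:R - s%:R *+ 2) / n%:R.
Proof. by move=> sn; rewrite /nkraw kraw1 // bin1. Qed.

Lemma nkraw_rec n s j : (s <= n)%N -> (j.+2 <= n)%N ->
  (n%:R - j.+1%:R) * nkraw n s j.+2 =
  (n%:R - s%:R *+ 2) * nkraw n s j.+1 - j.+1%:R * nkraw n s j.
Proof.
move=> sn jn; have := kraw_rec j sn; rewrite /nkraw.
have /(congr1 (fun i => i%:R : rat)) := mul_bin_left n j.
have /(congr1 (fun i => i%:R : rat)) := mul_bin_left n j.+1.
rewrite !natrM !natrB; try lia.
have : 'C(n, j.+2)%:R != 0 :> rat by rewrite pnatr_eq0 -lt0n bin_gt0.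
have : 'C(n, j.+1)%:R != 0 :> rat by rewrite pnatr_eq0 -lt0n bin_gt0 ltnW.
have : 'C(n, j)%:R != 0 :> rat by rewrite pnatr_eq0 -lt0n bin_gt0; lia.
set c0 := 'C(n, j)%:R; set c1 := 'C(n, j.+1)%:R; set c2 := 'C(n, j.+2)%:R.
set p0 := kraw _ _ j; set p1 := kraw _ _ j.+1; set p2 := kraw _ _ j.+2.
move=> c00 c10 c20 e2 e1 e.
have -> : (n%:R - j.+1%:R) * (p2 / c2) = j.+2%:R * p2 / c1.
  apply: (mulIf c20); apply: (mulIf c10).
  have -> : (n%:R - j.+1%:R) * (p2 / c2) * c2 * c1 = p2 * ((n%:R - j.+1%:R) * c1) by field.
  by rewrite -e2; field.
rewrite e mulrBl; congr (_ - _); first by rewrite mulrA.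
rewrite mulrA.
apply: (mulIf c00); apply: (mulIf c10).
have -> : (n%:R - j%:R) * p0 / c1 * c0 * c1 = p0 * ((n%:R - j%:R) * c0) by field.
by rewrite -e1; field.
Qed.

(* The recurrence preserves the bound as long as [(n - 2s) + j <= n - j]. *)
Lemma nkraw_bound n s j (c : rat) :
    (2 < n)%N -> (s.*2 <= n)%N -> 2 <= c -> n%:R - s%:R *+ 2 <= c ->
  (2 <= j <= s.+1)%N -> `|nkraw n s j| < c / n%:R.
Proof.
move=> n2 sn c2 dc; set d := n%:R - s%:R *+ 2 in dc *.
have n0 : 0 < n%:R :> rat by rewrite ltr0n; lia.
have le_sn : (s <= n)%N by lia.
have d0 : 0 <= d by rewrite subr_ge0 -mulrnA ler_nat; lia.
have c0 : 0 < c / n%:R by rewrite divr_gt0 //; lra.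
have b1 : `|nkraw n s 1| <= c / n%:R.
  by rewrite nkraw1 // ger0_norm ?ler_pM2r ?invr_gt0 // divr_ge0 // ltW.
elim/ltn_ind: j => -[//|[//|j]] IH /andP[_ js].
have lt_jn : (j.+2 <= n)%N by lia.
have nj : 0 < n%:R - j.+1%:R :> rat by rewrite subr_gt0 ltr_nat.
rewrite -(ltr_pM2l nj) -[X in X * `|_|]gtr0_norm // -normrM nkraw_rec // -/d.
(* Degree 2 is done by hand: it rests on degree 0, where the value 1 need not satisfy the bound. *)
case: j => [|j] in IH js lt_jn nj *.
  rewrite nkraw0 nkraw1 // -/d.
  have sd : d <= n%:R - 2 by rewrite lerD2l lerN2 -mulrnA ler_nat; lia.
  have -> : d * (d / n%:R) - 1 * 1 = (d * d - n%:R) / n%:R by field; rewrite gt_eqF.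
  rewrite normrM normfV (gtr0_norm n0) mulrA ltr_pM2r ?invr_gt0 // ltr_norml.
  have n3 : 3 <= n%:R :> rat by rewrite ler_nat.
  apply/andP; split; nra.
apply: le_lt_trans (ler_normB _ _) _; rewrite (normrM d) (normrM j.+2%:R).
rewrite (ger0_norm d0) (@ger0_norm _ j.+2%:R) //.
have IH2 : `|nkraw n s j.+2| < c / n%:R by apply: IH => //; lia.
have IH1 : `|nkraw n s j.+1| <= c / n%:R.
  by case: j {IH2 nj} IH js lt_jn => [//|j] IH js lt_jn; apply/ltW/IH; lia.
(* The strict bound in degree [j.+2] enters with factor [d] and is lost when [d] is 0. Then
   strictness comes from degree [j.+1], whose value is 0 if that degree is 1. *)
have strict : 0 < d \/ `|nkraw n s j.+1| < c / n%:R.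
  have [d00|dN0] := eqVneq d 0; last by left; rewrite lt_def dN0.
  right; case: j {IH2 nj IH1} IH js lt_jn => [|j] IH js lt_jn; last by apply: IH; lia.
  by rewrite nkraw1 // -/d d00 mul0r normr0.
have js2 : j.+2%:R <= s%:R :> rat by rewrite ler_nat.
have dj : d + j.+2%:R <= n%:R - j.+2%:R by rewrite /d; lra.
have j2 : 0 < j.+2%:R :> rat by rewrite ltr0n.
apply: lt_le_trans (ler_wpM2r (ltW c0) dj); rewrite [ltRHS]mulrDl.
case: strict => [dp | lt1].
  by rewrite ltr_leD // ?ltr_pM2l // ler_pM2l.
by rewrite ler_ltD ?ltr_pM2l // ler_wpM2l // ltW.
Qed.

Lemma card_setI_setC (T : finType) (A B : {set T}) : (#|A :&: ~: B| = #|A| - #|A :&: B|)%N.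
Proof. by rewrite -setDE cardsD. Qed.

Lemma ex_set_card n s : (s <= n)%N -> exists S : {set 'I_n}, #|S| = s.
Proof.
move=> sn; have [|S _ <-] := @ex_subset_card _ [set: 'I_n] s; last by exists S.
by rewrite cardsT card_ord.
Qed.

(** Both sides sum the sign of the intersection over all pairs of an [s]-set and a [j]-set. *)
Lemma kraw_sym n s j : (s <= n)%N -> (j <= n)%N ->
  'C(n, s)%:R * kraw n s j = 'C(n, j)%:R * kraw n j s.
Proof.
move=> sn jn.
have E a b : 'C(n, a)%:R * kraw n a b =
  \sum_(S : {set 'I_n} | #|S| == a) \sum_(T : {set 'I_n} | #|T| == b) (-1) ^+ #|S :&: T|.
  rewrite -[in LHS](card_ord n) -card_draws -sum1_card natr_sum mulr_suml.
  rewrite big_mkcond [RHS]big_mkcond; apply: eq_bigr => S _; rewrite inE.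
  by case: eqP => // <-; rewrite mul1r kraw_sum card_ord.
rewrite !E exchange_big; apply: eq_bigr => S _; apply: eq_bigr => T _.
by rewrite setIC.
Qed.

Lemma kraw_compl_card n s j : (s <= n)%N -> (j <= n)%N ->
  kraw n s (n - j) = (-1) ^+ s * kraw n s j.
Proof.
move=> sn jn; have [S <-] := ex_set_card sn.
rewrite -!kraw_sum (reindex_inj (@setC_inj 'I_n)) mulr_sumr.
apply: eq_big => [T|T _].
  have := cardsC T; rewrite card_ord; lia.
rewrite card_setI_setC; have := subset_leq_card (subsetIl S T).
by move=> le; rewrite -signr_odd oddB // signr_addb !signr_odd.
Qed.

Lemma kraw_compl n s j : (s <= n)%N -> (j <= n)%N ->
  kraw n (n - s) j = (-1) ^+ j * kraw n s j.
Proof.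
move=> sn jn; have [S eS] := ex_set_card sn.
have eS' : #|~: S| = (n - s)%N by rewrite cardsCs setCK card_ord eS.
rewrite -eS' -eS -!kraw_sum mulr_sumr; apply: eq_bigr => T /eqP <-.
rewrite setIC card_setI_setC setIC; have := subset_leq_card (subsetIr S T).
by move=> le; rewrite -signr_odd oddB // signr_addb !signr_odd.
Qed.

(** The left side is the value at 1 and at n - 1 (see [kraw_min]). Complementation moves both the
    point and the degree into the lower half, where [nkraw_bound] controls the absolute value. *)
Lemma kraw_gap n k s :
    (k < n)%N -> (n < 2 * k - 1)%N -> ~~ odd k ->
    (s <= n)%N -> s != 1 -> s != n.-1 ->
  'C(n, k)%:R * (n%:R - k%:R *+ 2) / n%:R < kraw n s k.
Proof.
move=> kn nk ek.
have n0 : 0 < n%:R :> rat by rewrite ltr0n; lia.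
have C0 : 0 < 'C(n, k)%:R :> rat by rewrite ltr0n bin_gt0 ltnW.
have kr : n%:R - k%:R *+ 2 <= -2 :> rat.
  have : (n + 2)%:R <= (k * 2)%:R :> rat by rewrite ler_nat; lia.
  by rewrite natrD mulrnA; lra.
wlog sn : s / (s.*2 <= n)%N.
  move=> wl le_sn s1 sn1; have [h|h] := leqP s.*2 n; first exact: wl.
  have := wl (n - s)%N; rewrite kraw_compl; try lia.
  rewrite -signr_odd (negbTE ek) expr0 mul1r; apply; lia.
move=> le_sn s1 sn1; case: s => [|[//|s]] in sn le_sn s1 sn1 *.
  suff -> : kraw n 0 k = 'C(n, k)%:R by rewrite -mulrA gtr_pMr // ltr_pdivrMr //; lra.
  by have := @kraw_sym n 0 k isT (ltnW kn); rewrite kraw0 bin0 mulr1 mul1r.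
(* Passing to degree n - k costs only a sign, which the absolute value absorbs, and turns n - 2k
   into -(n - 2m). *)
set m := (n - k)%N.
have -> : 'C(n, k) = 'C(n, m) by rewrite /m bin_sub // ltnW.
have -> : kraw n s.+2 k = (-1) ^+ s.+2 * kraw n s.+2 m.
  by rewrite -[in LHS](subKn (ltnW kn)) kraw_compl_card // leq_subr.
have -> : n%:R - k%:R *+ 2 = - (n%:R - m%:R *+ 2) :> rat.
  by rewrite /m natrB; [lra | exact: ltnW].
have Cm : 0 < 'C(n, m)%:R :> rat by rewrite ltr0n bin_gt0 leq_subr.
have Cs : 0 < 'C(n, s.+2)%:R :> rat by rewrite ltr0n bin_gt0.
suff bd : `|nkraw n s.+2 m| < (n%:R - m%:R *+ 2) / n%:R.
  have : `|(-1) ^+ s.+2 * kraw n s.+2 m|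
       < 'C(n, m)%:R * ((n%:R - m%:R *+ 2) / n%:R).
    have -> : kraw n s.+2 m = 'C(n, m)%:R * nkraw n s.+2 m.
      by rewrite /nkraw mulrC divfK ?gt_eqF.
    by rewrite normrM normrX normrN1 expr1n mul1r normrM gtr0_norm // ltr_pM2l.
  by rewrite ltr_norml => /andP[+ _]; rewrite mulrN mulNr mulrA.
have m0 : (0 < m)%N by rewrite subn_gt0.
have m2n : (m.*2 + 2 <= n)%N by rewrite /m; lia.
have c2 : 2 <= n%:R - m%:R *+ 2 :> rat.
  have : (m * 2 + 2)%:R <= n%:R :> rat by rewrite ler_nat muln2.
  by rewrite natrD mulrnA; lra.
(* [nkraw n s m] is symmetric in [s] and [m], so [nkraw_bound] applies with the larger one as evaluation point. *)
have [sm|ms] := leqP s.+2 m.+1.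
  have -> : nkraw n s.+2 m = nkraw n m s.+2.
    rewrite /nkraw; apply: (mulIf (lt0r_neq0 Cm)); rewrite divfK ?gt_eqF //.
    apply: (mulfI (lt0r_neq0 Cs)); rewrite kraw_sym ?leq_subr //; field.
    by rewrite gt_eqF.
  by apply: nkraw_bound => //; lia.
have lt_ms : n%:R - s.+2%:R *+ 2 < n%:R - m%:R *+ 2 :> rat.
  by rewrite ltrD2l ltrN2 ltr_pMn2r // ltr_nat; lia.
case: (ltnP 1 m) => m2.
  by apply: nkraw_bound => //; [lia | exact: ltW | lia].
(* Degree 1 is outside the range of [nkraw_bound], but there the value is explicit and [lt_ms]
   suffices. *)
have m1 : m = 1 by lia.
rewrite m1 in lt_ms *; rewrite nkraw1 // ger0_norm.
  by rewrite ltr_pM2r // invr_gt0.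
by rewrite divr_ge0 ?ler0n // subr_ge0 -mulrnA ler_nat; lia.
Qed.
End Krawtchouk.

(** * Fourier analysis on the cube and the equality case of the Rayleigh bound *)

Section Fourier.
Local Open Scope ring_scope.

Lemma kraw_min n k s : (k <= n)%N -> (0 < n)%N -> ~~ odd k -> s = 1 \/ s = n.-1 ->
  kraw n s k = 'C(n, k)%:R * (n%:R - k%:R *+ 2) / n%:R.
Proof.
move=> kn n0 ek.
have k1 : kraw n 1 k = 'C(n, k)%:R * (n%:R - k%:R *+ 2) / n%:R.
  have nN0 : n%:R != 0 :> rat by rewrite pnatr_eq0 -lt0n.
  (* Exchanging point and degree reduces K_k(1) to the linear K_1(k) = n - 2k. *)
  by rewrite -kraw1 // -kraw_sym // bin1 mulrAC divff // mul1r.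
case=> -> //; rewrite -subn1 kraw_compl // k1.
by rewrite -signr_odd (negbTE ek) expr0 mul1r.
Qed.

Variable n : nat.
Implicit Types (S T : {set 'I_n}) (x y : {ffun 'I_n -> bool}).
Implicit Types G : {ffun 'I_n -> bool} -> rat.

Definition flip T x : {ffun 'I_n -> bool} := [ffun i => x i (+) (i \in T)].

Definition chi S x : rat := \prod_(i in S) (-1) ^+ x i.

Definition fourier G S : rat := \sum_x G x * chi S x.

(** The adjacency operator of the distance-[k] graph on the whole cube. *)
Definition nbr_sum k G x : rat := \sum_(T : {set 'I_n} | #|T| == k) G (flip T x).

Lemma flipK T : involutive (flip T).
Proof. by move=> x; apply/ffunP => i; rewrite !ffunE addbK. Qed.

Lemma chi_flip S T x : chi S (flip T x) = (-1) ^+ #|S :&: T| * chi S x.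
Proof.
rewrite /chi -prodr_const big_mkcond [X in _ = X * _]big_mkcond [X in _ = _ * X]big_mkcond.
rewrite -big_split; apply: eq_bigr => i _ /=; rewrite !inE ffunE signr_addb.
by case: (i \in S); case: (i \in T) => //=; rewrite ?mulr1 ?mul1r // mulrC.
Qed.

(** The sum factors over coordinates, and a coordinate where the words differ contributes 1 - 1. *)
Lemma chi_orth x y : \sum_S chi S x * chi S y = (2 ^+ n) *+ (x == y).
Proof.
have -> : \sum_S chi S x * chi S y = \prod_i ((-1) ^+ (x i (+) y i) + 1).
  rewrite bigA_distr; apply: eq_bigr => S _; rewrite -big_mkcond /= -big_split /=.
  by apply: eq_bigr => i _; rewrite signr_addb.
have [->|] := eqVneq x y.
  rewrite (eq_bigr (fun=> 2)) => [|i _]; last by rewrite addbb expr0.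
  by rewrite prodr_const card_ord.
move/eqP => xy; have /forallPn[i xyi] : ~~ [forall i, x i == y i].
  by apply/negP => /forallP xy_; apply: xy; apply/ffunP => i; apply/eqP.
rewrite (bigD1 i) //=; move: xyi; case: (x i); case: (y i) => //= _;
  by rewrite expr1 addNr mul0r.
Qed.

Lemma fourier_inv G x : \sum_S fourier G S * chi S x = 2 ^+ n * G x.
Proof.
rewrite /fourier; under eq_bigr do rewrite mulr_suml.
rewrite exchange_big /= (bigD1 x) //= [X in _ + X]big1 => [|y yx].
  by under eq_bigr do rewrite -mulrA; rewrite -mulr_sumr chi_orth eqxx addr0 mulrC.
by under eq_bigr do rewrite -mulrA; rewrite -mulr_sumr chi_orth (negbTE yx) mulr0.
Qed.

Lemma parseval G H : \sum_S fourier G S * fourier H S = 2 ^+ n * \sum_x G x * H x.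
Proof.
rewrite mulr_sumr; under eq_bigr do rewrite {2}/fourier mulr_sumr.
rewrite exchange_big; apply: eq_bigr => x _ /=.
under eq_bigr do rewrite [H x * _]mulrC mulrA.
by rewrite -mulr_suml fourier_inv mulrA.
Qed.

(** Flipping [T] multiplies a character by a sign, so the characters diagonalize the adjacency
    operator. *)
Lemma fourier_nbr_sum k G S :
  fourier (nbr_sum k G) S = kraw n #|S| k * fourier G S.
Proof.
rewrite -kraw_sum mulr_suml /fourier /nbr_sum.
under eq_bigr do rewrite mulr_suml.
rewrite exchange_big; apply: eq_bigr => T _ /=; rewrite mulr_sumr.
rewrite (reindex_inj (inv_inj (flipK T))); apply: eq_bigr => x _.
by rewrite flipK chi_flip mulrCA.
Qed.

Lemma quad_form_fourier k G :
  2 ^+ n * \sum_x G x * nbr_sum k G x = \sum_(S : {set 'I_n}) kraw n #|S| k * fourier G S ^+ 2.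
Proof.
by rewrite -parseval; apply: eq_bigr => S _; rewrite fourier_nbr_sum mulrCA -expr2.
Qed.

(* Equality in the Rayleigh bound forces every G i into the least eigenspace. *)
Lemma fourier_rayleigh (I : finType) (G : I -> {ffun 'I_n -> bool} -> rat) k tau :
    (forall S, tau <= kraw n #|S| k) ->
    \sum_i \sum_x G i x * nbr_sum k (G i) x = tau * \sum_i \sum_x G i x * G i x ->
  forall i S, tau < kraw n #|S| k -> fourier (G i) S = 0.
Proof.
move=> tau_le eqG i S ltS.
have t_ge0 j (R : {set 'I_n}) : 0 <= (kraw n #|R| k - tau) * fourier (G j) R ^+ 2.
  by rewrite mulr_ge0 ?sqr_ge0 // subr_ge0.
have : \sum_j \sum_(R : {set 'I_n}) (kraw n #|R| k - tau) * fourier (G j) R ^+ 2 = 0.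
  have: 2 ^+ n * \sum_j \sum_x G j x * nbr_sum k (G j) x
      - tau * (2 ^+ n * \sum_j \sum_x G j x * G j x) = 0.
    by rewrite eqG mulrCA subrr.
  rewrite !mulr_sumr -sumrB => e0; rewrite -[RHS]e0; apply: eq_bigr => j _.
  rewrite quad_form_fourier -parseval mulr_sumr -sumrB; apply: eq_bigr => R _.
  by rewrite mulrBl -expr2.
move/psumr_eq0P => /(_ (fun j _ => sumr_ge0 _ (fun R _ => t_ge0 j R)) i isT).
move/psumr_eq0P => /(_ (fun R _ => t_ge0 i R) S isT) /eqP.
by rewrite mulf_eq0 subr_eq0 gt_eqF //= sqrf_eq0 => /eqP.
Qed.

Lemma odd_card_addb T : odd #|T| = \big[addb/false]_i (i \in T).
Proof.
rewrite -sum1_card big_mkcond /= (big_morph odd oddD (erefl _)).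
by apply: eq_bigr => i _; case: (i \in T).
Qed.

Lemma odd_weight x : odd (weight x) = \big[addb/false]_i x i.
Proof. by rewrite odd_card_addb; apply: eq_bigr => i _; rewrite inE. Qed.

Lemma odd_weight_flip T x : odd (weight (flip T x)) = odd (weight x) (+) odd #|T|.
Proof.
rewrite !odd_weight odd_card_addb -big_split.
by apply: eq_bigr => i _; rewrite ffunE.
Qed.

Lemma chiT x : chi setT x = (-1) ^+ odd (weight x).
Proof.
rewrite /chi odd_weight (big_morph (fun b : bool => (-1 : rat) ^+ b) (@signr_addb _) (erefl _)).
by apply: eq_bigl => i; rewrite inE.
Qed.

(** The product of the two characters is the parity character, which is 1 on even words. Thus levels
    1 and n - 1 restrict to the same functions. *)
Lemma chi_setC S x : ~~ odd (weight x) -> chi (~: S) x = chi S x.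
Proof.
move=> /negbTE ex; have := chiT x; rewrite ex expr0 /chi.
rewrite (bigID (mem S)) /=.
rewrite (eq_bigl (fun i => i \in S)) => [|i]; last by rewrite inE.
rewrite [X in _ * X](eq_bigl (fun i => i \in ~: S)) => [|i]; last by rewrite !inE.
have : chi S x * chi S x = 1.
  by rewrite -big_split big1 //= => i _; rewrite -signr_addb addbb.
by rewrite /chi => pp pq; rewrite -[RHS]mulr1 -[X in _ = _ * X]pq mulrA pp mul1r.
Qed.

Lemma fourier_linear G :
    (2 < n)%N ->
    (forall S, #|S| != 1 -> #|S| != n.-1 -> fourier G S = 0) ->
  exists u : 'I_n -> rat, forall x, ~~ odd (weight x) ->
    G x = \sum_a u a * (-1) ^+ x a.
Proof.
(* The singleton and its complement merge on even words. Since n > 2, the levels 1 and n - 1 are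
   distinct, so no set is counted twice. *)
move=> n2 G0; exists (fun a => (fourier G [set a] + fourier G (~: [set a])) / 2 ^+ n).
move=> x ex; apply: (mulfI (_ : 2 ^+ n != 0)); first by rewrite expf_neq0.
rewrite -fourier_inv mulr_sumr.
have sum1 (F : {set 'I_n} -> rat) : \sum_(S : {set 'I_n} | #|S| == 1) F S = \sum_a F [set a].
  have -> : \sum_a F [set a] = \sum_(S in [set [set a] | a : 'I_n]) F S.
    by rewrite big_imset //= => a b _ _ /set1_inj.
  apply: eq_bigl => S; apply/cards1P/imsetP => [[a ->]|[a _ ->]]; by exists a.
rewrite (bigID (fun S => #|S| == 1)) /= sum1.
rewrite [X in _ + X](bigID (fun S => #|S| == n.-1)) /= [X in _ + (_ + X)]big1 => [|S]; last first.
  by case/andP => S1 S2; rewrite G0 ?mul0r.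
rewrite addr0 (reindex_inj (@setC_inj 'I_n)) /=.
rewrite (eq_bigl (fun S => #|S| == 1)) => [|S]; last first.
  have := cardsC S; rewrite card_ord; move: #|S| #|~: S| => p q; lia.
rewrite sum1 -big_split; apply: eq_bigr => a _ /=.
rewrite chi_setC // /chi big_set1 -mulrDl.
rewrite [RHS]mulrA; congr (_ * _); by rewrite mulrCA divff ?mulr1 ?expf_neq0.
Qed.

End Fourier.

(** * Linear forms with values 1 and -1, and the coordinates of a homomorphism *)

Section Signs.
Local Open Scope ring_scope.

Lemma sum_sign_mul m (p q : {ffun 'I_m -> bool}) :
  \sum_i (-1) ^+ p i * (-1) ^+ q i = m%:R - (hdist p q)%:R *+ 2 :> rat.
Proof.
rewrite /hdist -sum1_card natr_sum -sumrMnl [in RHS]big_mkcond /=.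
have -> : m%:R = \sum_(i < m) 1 :> rat by rewrite sumr_const card_ord.
rewrite -sumrB; apply: eq_bigr => i _; rewrite inE.
by case: (p i); case: (q i) => /=; lra.
Qed.

Lemma hdist_flip n (T : {set 'I_n}) x : hdist x (flip T x) = #|T|.
Proof.
apply: eq_card => i; rewrite !inE ffunE.
by case: (x i); case: (i \in T).
Qed.

Lemma sum_delta_addb n (a : 'I_n) (b : bool) :
  \big[addb/false]_i ((i == a) && b) = b.
Proof.
by rewrite (bigD1 a) //= eqxx big1 ?addbF //= => i /negbTE->.
Qed.

(* Averaging the square over the sign patterns on five coordinates with an even number of minus signs isolates [u a * u c]; with only four coordinates the fourth sign would be the product of the other three. *)
Lemma sign_linear_orth n (u : 'I_n -> rat) (a c : 'I_n) :
    (4 < n)%N ->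
    (forall x : {ffun 'I_n -> bool}, ~~ odd (weight x) ->
       (\sum_i u i * (-1) ^+ x i) ^+ 2 = 1) ->
  a != c -> u a * u c = 0.
Proof.
move=> n4 sq1 ac.
have /card_gt2P[p [q [r [[pA qA rA] [pq qr rp]]]]] : (2 < #|~: [set a; c]|)%N.
  have := cardsC [set a; c]; rewrite cards2 ac card_ord.
  move: #|~: _| => w; lia.
move: pA qA rA; rewrite !inE !negb_or => /andP[pa pc] /andP[qa qc] /andP[ra rc].
(* Four free bits at [a], [c], [p], [q], and a parity bit at [r] that keeps the weight even. *)
pose w b1 b2 b3 b4 : {ffun 'I_n -> bool} :=
  [ffun i => ((i == a) && b1) (+) (((i == c) && b2) (+) (((i == p) && b3) (+)
     (((i == q) && b4) (+) ((i == r) && (b1 (+) (b2 (+) (b3 (+) b4)))))))].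
have ew b1 b2 b3 b4 : ~~ odd (weight (w b1 b2 b3 b4)).
  rewrite odd_weight; under eq_bigr do rewrite ffunE.
  rewrite !big_split /= !sum_delta_addb.
  by case: b1 b2 b3 b4 => [] [] [] [].
pose rest := \sum_(i | [&& i != a, i != c, i != p, i != q & i != r]) u i.
have sw b1 b2 b3 b4 : \sum_i u i * (-1) ^+ w b1 b2 b3 b4 i =
  u a * (-1) ^+ b1 + (u c * (-1) ^+ b2 + (u p * (-1) ^+ b3 + (u q * (-1) ^+ b4 +
    (u r * (-1) ^+ (b1 (+) (b2 (+) (b3 (+) b4))) + rest)))).
  have sym (i j : 'I_n) : i != j -> (j == i) = false by rewrite eq_sym => /negbTE.
  have simp := (sym _ _ ac, sym _ _ pa, sym _ _ pc, sym _ _ qa, sym _ _ qc, sym _ _ ra,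
    sym _ _ rc, sym _ _ pq, sym _ _ qr, sym _ _ rp, negbTE ac, negbTE pa, negbTE pc,
    negbTE qa, negbTE qc, negbTE ra, negbTE rc, negbTE pq, negbTE qr, negbTE rp, eqxx).
  rewrite (bigD1 a) //= (bigD1 c) /= ?simp // (bigD1 p) /= ?simp //.
  rewrite (bigD1 q) /= ?simp // (bigD1 r) /= ?simp // !ffunE !simp /= !addbF.
  do 5!congr (_ + _); apply: eq_big => [i|i]; first by rewrite -!andbA.
  rewrite -!andbA => /and5P[/negbTE ia /negbTE ic /negbTE ip /negbTE iq /negbTE ir].
  by rewrite ffunE ia ic ip iq ir mulr1.
have key b1 b2 b3 b4 := sq1 _ (ew b1 b2 b3 b4).
have {key}key b1 b2 b3 b4 :=
  etrans (congr1 (fun t => t ^+ 2) (esym (sw b1 b2 b3 b4))) (key b1 b2 b3 b4).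
move: key => /=; clear sw; move: (u a) (u c) (u p) (u q) (u r) rest => ua uc up uq ur R key.
(* Summing the sixteen equations with sign (-1)^(b1 + b2) leaves 32 [ua * uc] = 0; the argument is
   linear in the products of the unknowns. *)
have K0 := key false false false false; have K1 := key false false false true.
have K2 := key false false true false; have K3 := key false false true true.
have K4 := key false true false false; have K5 := key false true false true.
have K6 := key false true true false; have K7 := key false true true true.
have K8 := key true false false false; have K9 := key true false false true.
have K10 := key true false true false; have K11 := key true false true true.
have K12 := key true true false false; have K13 := key true true false true.
have K14 := key true true true false; have K15 := key true true true true.
rewrite /= ?expr0 ?expr1 in K0 K1 K2 K3 K4 K5 K6 K7 K8 K9 K10 K11 K12 K13 K14 K15.
clear key; lra.
Qed.

(** The coefficients cannot all vanish, as the zero word gives square 1; by pairwise orthogonality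
    only one survives. *)
Lemma sign_linear n (u : 'I_n -> rat) :
    (4 < n)%N ->
    (forall x : {ffun 'I_n -> bool}, ~~ odd (weight x) ->
       (\sum_i u i * (-1) ^+ x i) ^+ 2 = 1) ->
  exists a, forall x : {ffun 'I_n -> bool}, \sum_i u i * (-1) ^+ x i = u a * (-1) ^+ x a.
Proof.
move=> n4 sq1.
have /existsP[a ua] : [exists a, u a != 0].
  apply/existsPn => u0; have := sq1 [ffun=> false].
  rewrite odd_weight big1 => [/(_ isT)|i _]; last by rewrite ffunE.
  by rewrite big1 => [|i _]; [rewrite expr0n | have /negPn/eqP-> := u0 i; rewrite mul0r].
exists a => x; rewrite (bigD1 a) //= big1 ?addr0 // => i ia.
have /eqP := sign_linear_orth n4 sq1 ia; rewrite mulf_eq0 (negbTE ua) orbF => /eqP->.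
by rewrite mul0r.
Qed.

Lemma hom_linear (n k n' k' : nat) (f : HV n -> HV n') :
    (k < n)%N -> (n < 2 * k - 1)%N -> (n * k' = n' * k)%N -> ~~ odd k ->
    is_hom n k n' k' f ->
  forall i, exists u : 'I_n -> rat, forall v : HV n,
    (-1) ^+ (val (f v) i : bool) = \sum_a u a * (-1) ^+ (val v a : bool).
Proof.
move=> kn nk nk' ek hf i.
(* Extension by 0 is harmless: [k] is even, so distance-[k] neighbours have equal parity. *)
pose G i (x : {ffun 'I_n -> bool}) : rat :=
  if insub x is Some v then (-1) ^+ (val (f v) i : bool) else 0.
have Gv j (v : HV n) : G j (val v) = (-1) ^+ (val (f v) j : bool) by rewrite /G valK.
have Godd j x : odd (weight x) -> G j x = 0.
  by move=> ox; rewrite /G insubF // ox.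
have n0 : (0 < n)%N by lia.
pose tau : rat := 'C(n, k)%:R * (n%:R - k%:R *+ 2) / n%:R.
suff G0 (S : {set 'I_n}) : #|S| != 1 -> #|S| != n.-1 -> fourier (G i) S = 0.
  have n2 : (2 < n)%N by lia.
  have [u Gu] := fourier_linear n2 G0.
  by exists u => v; rewrite -Gv Gu // (valP v).
have leS (T : {set 'I_n}) : (#|T| <= n)%N by rewrite -[leqRHS]card_ord max_card.
move=> S1 Sn1; apply: (@fourier_rayleigh _ _ G k tau); last exact: kraw_gap.
  move=> T; have [T1|T1] := eqVneq #|T| 1; first by rewrite kraw_min // ?(ltnW kn) //; left.
  have [Tn1|Tn1] := eqVneq #|T| n.-1; first by rewrite kraw_min // ?(ltnW kn) //; right.
  by apply/ltW/kraw_gap.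
rewrite exchange_big [in RHS]exchange_big mulr_sumr; apply: eq_bigr => x _ /=.
have [ox|ex] := boolP (odd (weight x)).
  by rewrite !big1 ?mulr0 // => j _; rewrite Godd // mul0r.
pose v : HV n := Sub x ex.
have Gx j : G j x = (-1) ^+ (val (f v) j : bool) := Gv j v.
under eq_bigr do rewrite mulr_sumr; rewrite exchange_big /=.
(* The images of an edge differ in exactly k' places, so their signs multiply and sum to n' -
   2k'. *)
transitivity (\sum_(T : {set 'I_n} | #|T| == k) (n'%:R - k'%:R *+ 2 : rat)).
  apply: eq_bigr => T /eqP Tk.
  have ey : ~~ odd (weight (flip T x)) by rewrite odd_weight_flip Tk (negbTE ek) addbF.
  pose w : HV n := Sub (flip T x) ey.
  have Gy j : G j (flip T x) = (-1) ^+ (val (f w) j : bool) := Gv j w.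
  under eq_bigr do rewrite Gx Gy.
  rewrite sum_sign_mul.
  by have := hf v w; rewrite /Hadj /= hdist_flip Tk eqxx => /(_ isT)/eqP->.
rewrite sumr_const; under [in RHS]eq_bigr do rewrite Gx -signr_addb addbb expr0.
rewrite sumr_const card_ord /tau.
have -> : #|[pred T : {set 'I_n} | #|T| == k]| = 'C(n, k).
  rewrite -[in RHS](card_ord n) -card_draws; apply: eq_card => T; by rewrite !inE.
(* The equal ratios give n(n' - 2k') = n'(n - 2k), which makes the Rayleigh quotient exactly
   [tau]. *)
have /(congr1 (fun m => m%:R : rat)) := nk'; rewrite !natrM => e.
have nN0 : n%:R != 0 :> rat by rewrite pnatr_eq0 -lt0n.
rewrite -mulr_natl mulr1; apply: (mulfI nN0).
have -> : n%:R * ((n'%:R - k'%:R *+ 2) *+ 'C(n, k)) =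
  'C(n, k)%:R * (n%:R * n'%:R - (n%:R * k'%:R) *+ 2) :> rat by ring.
by rewrite e; field.
Qed.

(** Comparing two words removes the unknown sign of the single surviving term. *)
Lemma hom_coord (n k n' k' : nat) (f : HV n -> HV n') :
    (k < n)%N -> (n < 2 * k - 1)%N -> (n * k' = n' * k)%N -> ~~ odd k ->
    is_hom n k n' k' f ->
  forall i, exists a, forall v w : HV n,
    (val (f v) i != val (f w) i) = (val v a != val w a).
Proof.
move=> kn nk nk' ek hf i; have [u fu] := hom_linear kn nk nk' ek hf i.
(* No n satisfies 2 < n < 3, so the even number [k] is at least 4. *)
have n4 : (4 < n)%N by lia.
have sq1 (x : {ffun 'I_n -> bool}) : ~~ odd (weight x) -> (\sum_j u j * (-1) ^+ x j) ^+ 2 = 1.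
  by move=> ex; have <- := fu (Sub x ex); rewrite sqrr_sign.
have [a ua] := sign_linear n4 sq1; exists a => v w.
have := fu v; have := fu w; rewrite !ua; clear fu sq1 ua nk nk'.
move: (val (f v) i) (val (f w) i) (val v a) (val w a) (u a) => [] [] [] [] t;
  rewrite /= ?expr0 ?expr1 => e1 e2 //; lra.
Qed.
End Signs.

(** * Multiplicities of the coordinates, scaling of distances, and the repetition map *)

Lemma hdist_coords n n' (a : 'I_n' -> 'I_n) (x y : {ffun 'I_n -> bool})
    (x' y' : {ffun 'I_n' -> bool}) :
    (forall i, (x' i != y' i) = (x (a i) != y (a i))) ->
  hdist x' y' = \sum_(b | x b != y b) #|[set i | a i == b]|.
Proof.
move=> exy; rewrite /hdist -sum1_card (partition_big a (fun b => x b != y b)) /=.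
  apply: eq_bigr => b xyb; rewrite -sum1_card; apply: eq_bigl => i.
  by rewrite !inE exy; case: (a i =P b) => [->|]; rewrite ?andbT ?andbF.
by move=> i; rewrite inE exy.
Qed.

(** Two [k]-sets that differ only by exchanging [b] for [c] have the same sum; as k < n, their
    common k - 1 elements can avoid both. *)
Lemma uniform_fibres n k k' (m : 'I_n -> nat) :
    0 < k -> k < n -> (forall D : {set 'I_n}, #|D| = k -> \sum_(b in D) m b = k') ->
  forall b c, m b = m c.
Proof.
move=> k0 kn mD b c; have [->//|bc] := eqVneq b c.
have le_k : k.-1 <= #|~: [set b; c]|.
  have := cardsC [set b; c]; rewrite cards2 bc card_ord.
  move: #|~: _| => w; lia.
have [D sD cD] := ex_subset_card le_k.
have bD : b \notin D by apply/negP => /(subsetP sD); rewrite !inE eqxx.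
have cDn : c \notin D by apply/negP => /(subsetP sD); rewrite !inE eqxx orbT.
have := mD (b |: D); have := mD (c |: D).
rewrite !cardsU1 bD cDn cD add1n prednK // !big_setU1 //= => /(_ erefl) <- /(_ erefl).
by move/addIn.
Qed.

Lemma hom_scales (n k n' k' : nat) (f : HV n -> HV n') :
    k < n -> n < 2 * k - 1 -> n * k' = n' * k -> ~~ odd k ->
    is_hom n k n' k' f ->
  exists r, [/\ n' = n * r, k' = k * r &
    forall v w, hdist (val (f v)) (val (f w)) = hdist (val v) (val w) * r].
Proof.
move=> kn nk nk' ek hf.
have [a fa] := fin_all_exists (hom_coord kn nk nk' ek hf).
have hd v w := hdist_coords (fun i => fa i v w).
(* Apply the homomorphism to the edge joining the zero word to the indicator of [D]. *)
have mD (D : {set 'I_n}) : #|D| = k -> \sum_(b in D) #|[set i | a i == b]| = k'.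
  move=> Dk; pose x : {ffun 'I_n -> bool} := [ffun=> false].
  have ex : ~~ odd (weight x).
    by rewrite odd_weight big1 // => i _; rewrite ffunE.
  have ey : ~~ odd (weight (flip D x)) by rewrite odd_weight_flip Dk (negbTE ek) addbF.
  have := hf (Sub x ex) (Sub (flip D x) ey).
  rewrite /Hadj hd /= hdist_flip Dk eqxx => /(_ isT)/eqP <-.
  by apply: eq_bigl => i; rewrite !ffunE; case: (i \in D).
have k0 : 0 < k by lia.
have n0 : 0 < n by lia.
have mC := uniform_fibres k0 kn mD.
exists #|[set i | a i == Ordinal n0]|; set r := #|_|.
have mr b : #|[set i | a i == b]| = r by apply: mC.
have nr : n' = n * r.
  rewrite -[LHS](card_ord n') -sum1_card (partition_big a xpredT) //=.
  rewrite -[in RHS](card_ord n) -sum_nat_const; apply: eq_bigr => b _.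
  by rewrite -(mr b) -sum1_card; apply: eq_bigl => i; rewrite inE.
split=> //.
  by apply/eqP; rewrite -(eqn_pmul2l n0) nk' nr mulnAC mulnA.
move=> v w; rewrite hd; under eq_bigr do rewrite mr.
rewrite sum_nat_const /hdist; congr (_ * _); apply: eq_card => i; by rewrite inE.
Qed.

(** Concatenate [r] copies of the word: position i reads coordinate i mod n. *)
Lemma ex_repeat n r : 0 < n ->
  exists g : {ffun 'I_n -> bool} -> {ffun 'I_(n * r) -> bool},
    forall x y, weight (g x) = weight x * r /\ hdist (g x) (g y) = hdist x y * r.
Proof.
move=> n0; pose a (i : 'I_(n * r)) := Ordinal (ltn_pmod i n0).
have count (P : pred 'I_n) : #|[set i | P (a i)]| = #|[set i | P i]| * r.
  (* The periodic extension to all naturals lets the count be cut into [r] equal blocks of length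
     [n]. *)
  pose F j : nat := P (Ordinal (ltn_pmod j n0)).
  have cardF N (Q : pred 'I_N) : (forall i : 'I_N, Q i = F i :> nat) ->
      #|[set i | Q i]| = \sum_(0 <= i < N) F i.
    move=> QF; rewrite big_mkord -sum1_card big_mkcond /=.
    by apply: eq_bigr => i _; rewrite inE -QF; case: (Q i).
  rewrite (cardF _ (fun i => P (a i))) // (cardF _ P) => [|i]; last first.
    by rewrite /F; congr (nat_of_bool (P _)); apply: val_inj; rewrite /= modn_small.
  rewrite [(n * r)%N]mulnC big_nat_mul -[r in RHS](subn0 r) mulnC -sum_nat_const_nat.
  apply: eq_bigr => q _; rewrite -{1}[q * n]add0n big_addn mulSn addnK.
  apply: eq_bigr => j _; rewrite /F; congr (nat_of_bool (P _)).
  by apply: val_inj; rewrite /= addnC modnMDl.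
exists (fun x => [ffun i => x (a i)]) => x y; rewrite /weight /hdist -!count.
by split; apply: eq_card => i; rewrite !inE !ffunE.
Qed.

Theorem theorem5p5 (n k n' k' : nat) :
  k < n -> n < 2 * k - 1 -> 0 < k' -> n * k' = n' * k ->
  ~~ odd k -> ~~ odd k' ->
  ((exists f : HV n -> HV n', is_hom n k n' k' f) <-> (n %| n' /\ k %| k'))
  /\ (forall f : HV n -> HV n', is_hom n k n' k' f -> is_induced_embedding n k n' k' f).
Proof.
move=> kn nk k'0 nk' ek ek'; split; first split.
- case=> f /(hom_scales kn nk nk' ek) [r [n'r k'r _]].
  by split; apply/dvdnP; exists r; rewrite mulnC.
- case=> /dvdnP[r en'] _.
  have n0 : 0 < n by lia.
  rewrite mulnC in en'; subst n'.
  have k'r : k' = k * r by apply/eqP; rewrite -(eqn_pmul2l n0) nk' mulnAC mulnA.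
  have [g gP] := ex_repeat r n0.
  have eg (v : HV n) : ~~ odd (weight (g (val v))).
    by rewrite (gP _ (val v)).1 oddM negb_and (valP v).
  exists (fun v => Sub (g (val v)) (eg v)) => v w; rewrite /Hadj /= => /eqP vw.
  by rewrite (gP _ _).2 vw k'r.
move=> f /(hom_scales kn nk nk' ek) [r [_ k'r fr]].
(* Positivity of k' excludes the factor 0, so distances can be recovered and distance 0 forces
   equality. *)
have r0 : 0 < r by lia.
split=> [v w fvw | v w]; last by rewrite /Hadj fr k'r eqn_pmul2r.
have := fr v w; rewrite fvw {1}/hdist.
have -> : [set i | val (f w) i != val (f w) i] = set0.
  by apply/setP => i; rewrite !inE eqxx.
rewrite cards0 => /esym/eqP; rewrite muln_eq0 (gtn_eqF r0) orbF cards_eq0 => /eqP/setP e.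
by apply/val_inj/ffunP => i; have := e i; rewrite !inE => /negbFE/eqP.
Qed.
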